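(* Let $f:\mathbb R^6\to\mathbb R$ be given by $f(x)=x_2$ and consider the multisymplectic manifold $(\mathbb R^6,\omega^f)$, where $$\omega^f= dx^{135} -dx^{146}-dx^{236} + f(x)\cdot dx^{245}.$$ Then $(\mathbb R^6,\omega^f)$ does not admit any neighbourhood of $0$ on which the linear type of $(T_p\mathbb R^6,\omega^f_p)$ is constant. Notably, there is no chart $(U,\phi)$ of $\mathbb R^6$ near $0$ (i.e. with $0\in U$) such that $(\phi^{-1})^*(\omega^f|_U)$ is a three-form with constant coefficients on $\phi(U)\subset\mathbb R^6$. Furthermore, the group $$\mathrm{Diff}_{\omega^f}(\mathbb R^6)=\{\Phi:\mathbb R^6\to\mathbb R^6 \mid \Phi\text{ is a diffeomorphism and }\Phi^*(\omega^f)=\omega^f\}$$ does not act transitively on $\mathbb R^6$.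
   Context: $x_1,\dots,x_6$ are the standard coordinates on $\mathbb R^6$ and $dx^{ijk}$ denotes $dx^i\wedge dx^j\wedge dx^k$. On a finite-dimensional real vector space $V$, a form $\alpha\in\Lambda^kV^*$ is called non-degenerate if the map $V\to\Lambda^{k-1}V^*$, $v\mapsto\iota_v\alpha$, is injective. Two vector spaces of the same dimension with non-degenerate $k$-forms $(V,\alpha)$, $(\tilde V,\tilde\alpha)$ have the same linear type if there exists a linear isomorphism $\psi:V\to\tilde V$ with $\psi^*\tilde\alpha=\alpha$. A smooth manifold $M$ equipped with a closed differential form $\omega\in\Omega^k_{cl}(M)$ is called multisymplectic of degree $k$ if $\omega_p\in\Lambda^kT_p^*M$ is non-degenerate for all $p\in M$. *)

(* Defs.v *)
From HB Require Import structures.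
From mathcomp Require Import all_boot all_order all_algebra.
From mathcomp Require Import all_classical all_reals all_analysis.
Import Order.TTheory GRing.Theory Num.Theory numFieldNormedType.Exports.

Set Implicit Arguments.
Unset Strict Implicit.
Unset Printing Implicit Defensive.

Local Open Scope classical_set_scope.
Local Open Scope ring_scope.

(** * Linear algebra of k-forms *)

Section LinearForms.
Variable R : realType.

(* A k-form on V is a function of k vectors satisfying [kform]. *)
Definition multilinear (V : lmodType R) (k : nat) (a : ('I_k -> V) -> R) : Prop :=
  forall (v : 'I_k -> V) (i : 'I_k) (c : R) (x y : V),
    a (dfwith v i (c *: x + y)) = c * a (dfwith v i x) + a (dfwith v i y).

Definition alternating (V : lmodType R) (k : nat) (a : ('I_k -> V) -> R) : Prop :=
  forall (v : 'I_k -> V) (i j : 'I_k), i != j -> v i = v j -> a v = 0.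

Definition kform (V : lmodType R) (k : nat) (a : ('I_k -> V) -> R) : Prop :=
  multilinear a /\ alternating a.

Definition vcons (V : lmodType R) (k : nat) (x : V) (v : 'I_k -> V) : 'I_k.+1 -> V :=
  fun i => if unlift ord0 i is Some j then v j else x.

Definition contract (V : lmodType R) (k : nat) (a : ('I_k.+1 -> V) -> R) (x : V) :
    ('I_k -> V) -> R :=
  fun v => a (vcons x v).

Definition nondegenerate (V : lmodType R) (k : nat) (a : ('I_k.+1 -> V) -> R) : Prop :=
  injective (contract a).

Definition same_linear_type (V W : lmodType R) (k : nat)
    (a : ('I_k -> V) -> R) (b : ('I_k -> W) -> R) : Prop :=
  exists psi : {linear V -> W},
    bijective psi /\ forall v : 'I_k -> V, b (psi \o v) = a v.

(* Wedge product of k covectors, normalised so that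
   dx^1 /\ ... /\ dx^k takes the value 1 on (e_1, ..., e_k). *)
Definition wedge (V : lmodType R) (k : nat) (a : 'I_k -> V -> R) :
    ('I_k -> V) -> R :=
  fun v => \det (\matrix_(i < k, j < k) a i (v j)).

End LinearForms.

(** * Smooth maps and differential forms on open subsets of R^n *)

Section Smooth.
Variable R : realType.

(* [C_on k U f] is meant for U open: then it only depends on f restricted to U. *)
Fixpoint C_on (V W : normedModType R) (k : nat) (U : set V) (f : V -> W) : Prop :=
  match k with
  | 0%N => forall x, U x -> {for x, continuous f}
  | k'.+1 => (forall x, U x -> differentiable f x) /\
             forall v : V, C_on k' U (fun x => 'D_v f x)
  end.

Definition smooth_on (V W : normedModType R) (U : set V) (f : V -> W) : Prop :=
  forall k, C_on k U f.

(* A field of k-forms on V is a map p |-> w p, where w p : ('I_k -> V) -> R,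
   every tangent space being identified with V. *)
Definition differential_form (V : normedModType R) (k : nat) (U : set V)
    (w : V -> ('I_k -> V) -> R) : Prop :=
  (forall p, U p -> kform (w p)) /\
  (forall v : 'I_k -> V, smooth_on U (fun p => w p v)).

(* The invariant formula for d, evaluated on constant vector fields (whose Lie
   brackets vanish). *)
Definition exterior_d (V : normedModType R) (k : nat)
    (w : V -> ('I_k -> V) -> R) : V -> ('I_k.+1 -> V) -> R :=
  fun p v => \sum_(i < k.+1)
    (-1) ^+ i * 'D_(v i) (fun q => w q (fun j => v (lift i j))) p.

Definition closed_form (V : normedModType R) (k : nat) (U : set V)
    (w : V -> ('I_k -> V) -> R) : Prop :=
  forall p, U p -> forall v : 'I_k.+1 -> V, exterior_d w p v = 0.

Definition multisymplectic (V : normedModType R) (k : nat) (U : set V)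
    (w : V -> ('I_k.+1 -> V) -> R) : Prop :=
  [/\ differential_form U w, closed_form U w &
      forall p, U p -> nondegenerate (w p)].

Definition pullback (V W : normedModType R) (k : nat) (F : V -> W)
    (w : W -> ('I_k -> W) -> R) : V -> ('I_k -> V) -> R :=
  fun p v => w (F p) (fun i => 'd F p (v i)).

(* A chart (U, phi) together with its inverse psi : phi(U) -> U; the values of
   phi outside U and of psi outside phi(U) are irrelevant. *)
Definition is_chart (V W : normedModType R) (U : set V)
    (phi : V -> W) (psi : W -> V) : Prop :=
  [/\ open U, open (phi @` U), (forall x, U x -> psi (phi x) = x),
      smooth_on U phi & smooth_on (phi @` U) psi].

Definition diffeomorphism (V W : normedModType R) (Phi : V -> W) : Prop :=
  smooth_on setT Phi /\
  exists Psi : W -> V,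
    [/\ cancel Phi Psi, cancel Psi Phi & smooth_on setT Psi].

Definition Diff (V : normedModType R) (k : nat)
    (w : V -> ('I_k -> V) -> R) : set (V -> V) :=
  [set Phi | diffeomorphism Phi /\ pullback Phi w = w].

Definition acts_transitively (T : Type) (G : set (T -> T)) : Prop :=
  forall p q : T, exists2 Phi, G Phi & Phi p = q.

End Smooth.

(** * Coordinates *)

Section Coordinates.
Variables (R : realType) (n : nat).
Local Notation V := 'rV[R]_n.+1.

Definition dx (i : 'I_n.+1) : V -> R := fun v => v 0 i.

Definition constant_coefficients (k : nat) (U : set V)
    (w : V -> ('I_k -> V) -> R) : Prop :=
  exists c : {ffun 'I_k -> 'I_n.+1} -> R,
    forall p, U p -> forall v : 'I_k -> V,
      w p v = \sum_(I : {ffun 'I_k -> 'I_n.+1} |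
                      [forall a : 'I_k, forall b : 'I_k, (a < b)%N ==> (I a < I b)%N])
                 c I * wedge (fun a => dx (I a)) v.

End Coordinates.

(** * The forms omega^f on R^6 *)

Section Omega.
Variable R : realType.
Local Notation V := 'rV[R]_6.

(* The coordinates x_1, ..., x_6 are numbered from 1, the elements of 'I_6
   from 0. *)
Definition idx (i : nat) : 'I_6 := inord i.-1.

Definition x_ (i : nat) : V -> R := fun p => p 0 (idx i).

Definition dx3 (i j k : nat) : ('I_3 -> V) -> R :=
  wedge (tnth [tuple dx (idx i); dx (idx j); dx (idx k)]).

Definition omega (f : V -> R) : V -> ('I_3 -> V) -> R :=
  fun p v => dx3 1 3 5 v - dx3 1 4 6 v - dx3 2 3 6 v + f p * dx3 2 4 5 v.

End Omega.

(* Main.v *)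
Require Import Defs.
From HB Require Import structures.
From mathcomp Require Import all_boot all_order all_algebra.
From mathcomp Require Import all_classical all_reals all_analysis.
From mathcomp Require Import ring lra.
Import Order.TTheory GRing.Theory Num.Theory numFieldNormedType.Exports.

(** At a point p the form omega^f is
    [dx^135 - dx^146 - dx^236 + c dx^245] with [c = f p], and its linear type
    depends on the sign of [c].  What separates [c = 0] from [c < 0] is the
    existence of a nonzero vector u whose contraction [beta = iota_u omega] is
    a decomposable two-form, that is, [beta /\ beta = 0].  For [c = 0] the
    vector e_2 does it: its contraction is [- dx^36].  For [c < 0], the
    coefficients of [beta /\ beta] / 2 at 3456, 1256 and 1234 are, in terms of
    the coordinates of u,
      [u_1^2 - c u_2^2],  [u_3^2 - c u_4^2]  and  [u_6^2 - c u_5^2],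
    which vanish together only for [u = 0]; this is the complex type, [c = -1]
    giving the real part of dz^1 /\ dz^2 /\ dz^3 with z^k = x_(2k-1) + i x_(2k).
    See [decomposable_contraction_omega] and
    [not_decomposable_contraction_omega].

    Since f is 0 at the origin and negative at [- t e_2] for every [t > 0],
    each neighbourhood of the origin meets both types.  The two other
    impossibilities rest on the same comparison.  In a chart where the form
    has constant coefficients, the differentials of the chart identify the
    forms at any two points of its domain
    ([constant_pullback_same_linear_type]); and a
    diffeomorphism preserving omega^f identifies, through its differential,
    the form at a point with the form at the image ([Diff_same_linear_type]).

    Multisymplecticity itself holds because [d omega^f = df /\ dx^245], which
    vanishes for [f = x_2], and because each coordinate of u can be read off
    as a coefficient of [iota_u omega^f], up to sign and regardless of c. *)

Set Implicit Arguments.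
Unset Strict Implicit.
Unset Printing Implicit Defensive.

Local Open Scope classical_set_scope.
Local Open Scope ring_scope.

(** * Alternating forms and decomposable contractions *)

Section Forms.
Context {R : realType} {V : lmodType R}.

Lemma kform_wedge (k : nat) (a : 'I_k -> V -> R) :
  (forall i (c : R) x y, a i (c *: x + y) = c * a i x + a i y) ->
  kform (wedge a).
Proof.
move=> alin; split=> [v i c x y|v i j ij vij]; rewrite /wedge -det_tr.
  rewrite -[\det (\matrix_(i0, j) a i0 (dfwith v i x j))]det_tr.
  rewrite -[\det (\matrix_(i0, j) a i0 (dfwith v i y j))]det_tr.
  rewrite -[X in _ = _ + X]mul1r; apply: (@determinant_multilinear _ _ _ _ _ i).
  - by apply/rowP => j; rewrite !mxE !dfwithin alin mul1r.
  - by apply/matrixP => l m; rewrite !mxE !dfwithout ?neq_lift.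
  - by apply/matrixP => l m; rewrite !mxE !dfwithout ?neq_lift.
by apply: (determinant_alternate ij) => l; rewrite !mxE vij.
Qed.

Lemma kformD (k : nat) (a b : ('I_k -> V) -> R) :
  kform a -> kform b -> kform (fun v => a v + b v).
Proof.
move=> [aml aalt] [bml balt]; split=> [v i c x y|v i j ij vij].
  by rewrite aml bml; ring.
by rewrite (aalt _ _ _ ij vij) (balt _ _ _ ij vij) addr0.
Qed.

Lemma kformZ (k : nat) (c : R) (a : ('I_k -> V) -> R) :
  kform a -> kform (fun v => c * a v).
Proof.
move=> [aml aalt]; split=> [v i d x y|v i j ij vij].
  by rewrite aml; ring.
by rewrite (aalt _ _ _ ij vij) mulr0.
Qed.

Definition vec3 (x y z : V) : 'I_3 -> V := tnth [tuple x; y; z].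

(** The identity is the Plücker relation: with [beta = iota_u a] it says that
    [beta /\ beta] vanishes on x, y, z, t, so that beta is decomposable.  Stated
    on all vectors, it needs no basis and is clearly invariant under linear
    isomorphisms. *)
Definition decomposable_contraction (a : ('I_3 -> V) -> R) : Prop :=
  exists2 u : V, u <> 0 & forall x y z t : V,
    a (vec3 u x y) * a (vec3 u z t) - a (vec3 u x z) * a (vec3 u y t)
    + a (vec3 u x t) * a (vec3 u y z) = 0.

End Forms.

Lemma comp_vec3 (R : realType) (V W : lmodType R) (psi : V -> W) (x y z : V) :
  psi \o vec3 x y z = vec3 (psi x) (psi y) (psi z).
Proof. by apply/funext; case=> -[|[|[|m]]]. Qed.

Lemma same_linear_type_decomposable (R : realType) (V W : lmodType R)
    (a : ('I_3 -> V) -> R) (b : ('I_3 -> W) -> R) :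
  same_linear_type a b -> decomposable_contraction a -> decomposable_contraction b.
Proof.
move=> [psi [[psi' psiK psiK'] ab]] [u u0 plu].
exists (psi u) => [pu0|x y z t].
  by apply: u0; rewrite -[u]psiK pu0 -(linear0 psi) psiK.
rewrite -[x]psiK' -[y]psiK' -[z]psiK' -[t]psiK' -!comp_vec3 !ab.
exact: plu.
Qed.

(** * Affine functions of one coordinate *)

Section Smoothness.
Context {R : realType}.

Lemma smooth_cst (V W : normedModType R) (U : set V) (a : W) :
  smooth_on U (fun=> a).
Proof.
move=> k; elim: k a => [|k IHk] a /=; first by move=> x _; exact: cst_continuous.
split=> [x _|v]; first exact: differentiable_cst.
rewrite (_ : 'D_v _ = fun=> 0); first exact: IHk.
by apply/funext => x; rewrite derive_cst.
Qed.

(** The forms of interest, evaluated on fixed vectors, are functions of the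
    base point of this shape; their smoothness and their exterior derivative
    both follow from this differential. *)
Lemma is_diff_affine_coord (m : nat) (i : 'I_m) (a b : R) (p : 'rV[R]_m) :
  is_diff p (fun x : 'rV[R]_m => a + x 0 i * b : R) (fun x => x 0 i * b).
Proof.
pose l : 'rV[R]_m -> R := fun x => x 0 i * b.
have l_lin : linear l by move=> c x y; rewrite /l !mxE mulrDl -mulrA.
pose L : {linear 'rV[R]_m -> R} :=
  HB.pack l (GRing.isLinear.Build _ _ _ _ l l_lin).
have L_cont : continuous L.
  move=> x; rewrite /L /= /l.
  apply: (@continuousM _ 'rV[R]_m (fun y => y 0 i) (fun=> b)).
    exact: coord_continuous.
  exact: cst_continuous.
have dL : is_diff p L L.
  by apply: DiffDef; [exact: linear_differentiable|exact: diff_lin].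
apply: (is_diff_eq (is_diffD (is_diff_cst a p) dL)).
by rewrite add0r.
Qed.

Lemma derive_affine_coord (m : nat) (i : 'I_m) (a b : R) (p v : 'rV[R]_m) :
  'D_v (fun x : 'rV[R]_m => a + x 0 i * b : R) p = v 0 i * b.
Proof. by have [df dfE] := is_diff_affine_coord i a b p; rewrite deriveE// dfE. Qed.

Lemma smooth_affine_coord (m : nat) (i : 'I_m) (a b : R) (U : set 'rV[R]_m) :
  smooth_on U (fun x : 'rV[R]_m => a + x 0 i * b : R).
Proof.
have df x : differentiable (fun y : 'rV[R]_m => a + y 0 i * b : R) x.
  by case: (is_diff_affine_coord i a b x).
case=> [|k] /=; first by move=> x _; exact: differentiable_continuous.
split=> // v; rewrite (_ : 'D_v _ = fun=> v 0 i * b); first exact: smooth_cst.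
by apply/funext => x; exact: derive_affine_coord.
Qed.

End Smoothness.

(** * Charts and diffeomorphisms preserve linear types *)

Section Charts.
Context {R : realType}.

Lemma differentiable_smooth {V W : normedModType R} {U : set V} {F : V -> W} {p} :
  smooth_on U F -> U p -> differentiable F p.
Proof. by move=> /(_ 1%N)[+ _]; exact. Qed.

(** Chain rule for [G \o F]: this composite is the identity only near p, so
    its differential at p is computed through directional derivatives, which
    depend only on the germ. *)
Lemma diff_cancel {V W : normedModType R} {U : set V} {F : V -> W} {G p} :
  open U -> U p -> (forall x, U x -> G (F x) = x) ->
  differentiable F p -> differentiable G (F p) ->
  cancel ('d F p) ('d G (F p)).
Proof.
move=> Uo Up FK dF dG v.
transitivity ('D_v (G \o F) p).
  rewrite deriveE; last exact: differentiable_comp.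
  by rewrite (diff_comp dF dG).
rewrite -[RHS](derive_id p v); apply: near_eq_derive.
by apply: filterS (open_nbhs_nbhs (conj Uo Up)) => x /FK.
Qed.

Section Chart.
Context {V W : normedModType R} {U : set V} {phi : V -> W} {psi : W -> V}
  (chart : is_chart U phi psi).

Lemma chart_diffK p : U p -> cancel ('d phi p) ('d psi (phi p)).
Proof.
case: chart => Uo phiUo phiK smphi smpsi Up.
apply: (diff_cancel Uo) => //; first exact: differentiable_smooth smphi Up.
by apply: (differentiable_smooth smpsi); exists p.
Qed.

Lemma chart_diffKV p : U p -> cancel ('d psi (phi p)) ('d phi p).
Proof.
case: chart => Uo phiUo phiK smphi smpsi Up.
have phiUp : (phi @` U) (phi p) by exists p.
have := @diff_cancel _ _ (phi @` U) psi phi (phi p); rewrite phiK//; apply=> //.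
- by move=> _ [x Ux <-]; rewrite phiK.
- exact: differentiable_smooth smpsi phiUp.
- exact: differentiable_smooth smphi Up.
Qed.

(** If the form read in the chart is the same at [phi p] and [phi q], then
    going from the tangent space at p to the chart and back to the tangent
    space at q carries [w q] to [w p]. *)
Lemma constant_pullback_same_linear_type (k : nat) (w : V -> ('I_k -> V) -> R) p q :
  (forall y z, (phi @` U) y -> (phi @` U) z ->
    pullback psi w y = pullback psi w z) ->
  U p -> U q -> same_linear_type (w p) (w q).
Proof.
move=> wcst Up Uq; exists ('d psi (phi q) \o 'd phi p); split.
  exists ('d psi (phi p) \o 'd phi q) => v /=.
    by rewrite chart_diffKV// chart_diffK.
  by rewrite chart_diffKV// chart_diffK.
have phiK : forall x, U x -> psi (phi x) = x by case: chart.
move=> v; have /(congr1 (fun a => a ('d phi p \o v))) :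
    pullback psi w (phi q) = pullback psi w (phi p).
  by apply: wcst; [exists q | exists p].
rewrite /pullback !phiK//= => ->; congr (w p _).
by apply/funext => i; rewrite chart_diffK.
Qed.

End Chart.

Lemma Diff_same_linear_type (V : normedModType R) (k : nat)
    (w : V -> ('I_k -> V) -> R) (Phi : V -> V) p :
  Diff w Phi -> same_linear_type (w p) (w (Phi p)).
Proof.
move=> [[smPhi [Psi [PhiK PsiK smPsi]]] Phiw].
have imT : Phi @` setT = setT.
  by apply/seteqP; split=> // y _; exists (Psi y).
have chart : is_chart setT Phi Psi.
  by split; rewrite ?imT//; exact: openT.
exists ('d Phi p); split; last by move=> v; rewrite -[in RHS]Phiw.
by exists ('d Psi (Phi p)); [exact: (chart_diffK chart)|exact: (chart_diffKV chart)].
Qed.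

End Charts.

(** * Linear algebra of omega^f at a point *)

Section OmegaAlgebra.
Context {R : realType}.
Local Notation V := 'rV[R]_6.

Lemma idx_eq i j : (0 < i <= 6)%N -> (0 < j <= 6)%N -> (idx i == idx j) = (i == j).
Proof.
by case: i j => [|i] [|j] // i6 j6; rewrite -val_eqE /= !inordK.
Qed.

Lemma idx_surj (i : 'I_6) : exists2 j, (0 < j <= 6)%N & i = idx j.
Proof.
exists i.+1; first exact: (ltn_ord i).
by rewrite /idx /= inord_val.
Qed.

Definition e (i : nat) : V := delta_mx 0 (idx i).

Lemma x_e i j : (0 < i <= 6)%N -> (0 < j <= 6)%N -> x_ i (e j) = (i == j)%:R.
Proof. by move=> i6 j6; rewrite /x_ mxE eqxx/= idx_eq. Qed.

Lemma dx3_vec3 i j k (x y z : V) :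
  dx3 i j k (vec3 x y z) =
  x_ i x * (x_ j y * x_ k z - x_ j z * x_ k y)
  - x_ i y * (x_ j x * x_ k z - x_ j z * x_ k x)
  + x_ i z * (x_ j x * x_ k y - x_ j y * x_ k x).
Proof.
rewrite /dx3 /wedge /x_.
rewrite (expand_det_row _ ord0) !big_ord_recl big_ord0 /cofactor.
rewrite !(expand_det_row _ ord0) !big_ord_recl !big_ord0 /cofactor !det_mx11 !mxE.
rewrite /dx /vec3 !(tnth_nth 0) /= /bump /=.
rewrite !addn0 !add0n expr0 expr1 expr2; ring.
Qed.

(** The matrix of [iota_u omega^f_p] in the standard basis. *)
Definition entry (f : V -> R) (p u : V) (i j : nat) : R :=
  omega f p (vec3 u (e i) (e j)).

Lemma entryE (f : V -> R) (p u : V) :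
  ((entry f p u 1 2 = 0) * (entry f p u 1 3 = x_ 5 u)
   * (entry f p u 1 4 = - x_ 6 u) * (entry f p u 1 5 = - x_ 3 u)
   * (entry f p u 1 6 = x_ 4 u) * (entry f p u 2 3 = - x_ 6 u)
   * (entry f p u 2 4 = (f p * x_ 5 u)%R) * (entry f p u 2 5 = - (f p * x_ 4 u)%R)
   * (entry f p u 2 6 = x_ 3 u) * (entry f p u 3 4 = 0)
   * (entry f p u 3 5 = x_ 1 u) * (entry f p u 3 6 = - x_ 2 u)
   * (entry f p u 4 5 = (f p * x_ 2 u)%R) * (entry f p u 4 6 = - x_ 1 u)
   * (entry f p u 5 6 = 0))%type.
Proof.
rewrite /entry /omega; do !split; rewrite !dx3_vec3 !x_e //=; ring.
Qed.

Lemma eq0_x_ (u : V) : (forall i, (0 < i <= 6)%N -> x_ i u = 0) -> u = 0.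
Proof.
move=> xu; apply/rowP => i; have [j j6 ->] := idx_surj i.
by rewrite mxE; exact: xu.
Qed.

(** The entries 35, 36, 15, 16, 13 and 14 of the contraction by u are, up to
    sign, the six coordinates of u, whatever the value of [f p]. *)
Lemma nondegenerate_omega (f : V -> R) p : Defs.nondegenerate (omega f p).
Proof.
move=> x y xy.
have {}xy i j : entry f p x i j = entry f p y i j.
  have vconsE z : vec3 z (e i) (e j) = vcons z (tnth [tuple e i; e j]).
    by apply/funext; case=> -[|[|[|m]]] lt3 //=; rewrite /vcons;
      case: unliftP => [k /(congr1 val)|/(congr1 val)] //=; case: k => -[|[|k]].
  by rewrite /entry !vconsE; exact: (congr1 (fun g => g _) xy).
apply/eqP; rewrite -subr_eq0; apply/eqP/eq0_x_.
have x_B k : x_ k (x - y) = x_ k x - x_ k y by rewrite /x_ !mxE.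
have := (xy 3 5, xy 3 6, xy 1 5, xy 1 6, xy 1 3, xy 1 4)%N.
rewrite !entryE => -[[[[[x1 /oppr_inj x2] /oppr_inj x3] x4] x5] /oppr_inj x6].
by case=> [|[|[|[|[|[|[|k]]]]]]] // _; rewrite x_B ?x1 ?x2 ?x3 ?x4 ?x5 ?x6 subrr.
Qed.

(** For [f p = 0] the contraction by e_2 is [- dx^36]. *)
Lemma decomposable_contraction_omega (f : V -> R) p :
  f p = 0 -> decomposable_contraction (omega f p).
Proof.
move=> fp0; exists (e 2) => [e20|x y z t].
  by have := @x_e 2 2 isT isT; rewrite e20 /x_ mxE => /eqP; rewrite eq_sym oner_eq0.
rewrite /omega fp0 !dx3_vec3 !x_e//=; ring.
Qed.

(** Each Plücker relation on a suitable quadruple of basis vectors is a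
    definite quadratic form in two of the coordinates of u, because
    [- f p > 0]. *)
Lemma not_decomposable_contraction_omega (f : V -> R) p :
  f p < 0 -> ~ decomposable_contraction (omega f p).
Proof.
move=> fp0 [u u0 plu].
have sq0 (a b : R) : a ^+ 2 - f p * b ^+ 2 = 0 -> a = 0 /\ b = 0.
  move=> ab0; have fb_ge0 : 0 <= - f p * b ^+ 2.
    by rewrite mulr_ge0 ?sqr_ge0// oppr_ge0 ltW.
  have a_ge0 := sqr_ge0 a.
  have /eqP : a ^+ 2 = 0 by lra.
  have /eqP : - f p * b ^+ 2 = 0 by lra.
  by rewrite mulf_eq0 oppr_eq0 lt_eqF//= !sqrf_eq0 => /eqP-> /eqP->.
have /sq0[x1 x2] : x_ 1 u ^+ 2 - f p * x_ 2 u ^+ 2 = 0.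
  by rewrite -[RHS](plu (e 3) (e 4) (e 5) (e 6)) -!/(entry _ _ _ _ _) !entryE; ring.
have /sq0[x3 x4] : x_ 3 u ^+ 2 - f p * x_ 4 u ^+ 2 = 0.
  by rewrite -[RHS](plu (e 1) (e 2) (e 5) (e 6)) -!/(entry _ _ _ _ _) !entryE; ring.
have /sq0[x6 x5] : x_ 6 u ^+ 2 - f p * x_ 5 u ^+ 2 = 0.
  by rewrite -[RHS](plu (e 1) (e 2) (e 3) (e 4)) -!/(entry _ _ _ _ _) !entryE; ring.
by apply/u0/eq0_x_; case=> [|[|[|[|[|[|[|k]]]]]]].
Qed.

Lemma not_same_linear_type_omega (f : V -> R) p q :
  f p = 0 -> f q < 0 -> ~ same_linear_type (omega f p) (omega f q).
Proof.
move=> fp0 fq0 /same_linear_type_decomposable pq.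
exact/(not_decomposable_contraction_omega fq0)/pq/decomposable_contraction_omega.
Qed.

(** * The multisymplectic form omega^f for f = x_2 *)

Lemma kform_dx3 i j k : kform (@dx3 R i j k).
Proof.
apply: kform_wedge => l c x y.
by case: l => -[|[|[|l]]] l3 //; rewrite !(tnth_nth (fun=> 0))/= /dx !mxE.
Qed.

Lemma kform_omega (f : V -> R) p : kform (omega f p).
Proof.
have -> : omega f p = fun v => dx3 1 3 5 v + (-1) * dx3 1 4 6 v
    + (-1) * dx3 2 3 6 v + f p * dx3 2 4 5 v.
  by apply/funext => v; rewrite /omega !mulN1r.
by do 3?[apply: kformD]; do ?apply: kformZ; exact: kform_dx3.
Qed.

(** By Laplace expansion along the first row, the exterior derivative is
    [dx^2 /\ dx^2 /\ dx^4 /\ dx^5], a determinant with two equal rows. *)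
Lemma closed_omega_x2 : closed_form setT (omega (@x_ R 2)).
Proof.
move=> p _ v.
transitivity
  (wedge (tnth [tuple dx (idx 2); dx (idx 2); dx (idx 4); dx (idx 5)]) v); last first.
  by apply: (@determinant_alternate _ _ _ ord0 (lift ord0 ord0)) => // j; rewrite !mxE.
rewrite /wedge (expand_det_row _ ord0); apply: eq_bigr => i _.
rewrite derive_affine_coord mulrCA mxE /cofactor add0n.
congr (_ * (_ * \det _)); apply/matrixP => l j; rewrite !mxE.
by case: l => -[|[|[|l]]].
Qed.

Lemma multisymplectic_omega_x2 : multisymplectic setT (omega (@x_ R 2)).
Proof.
split=> [||p _]; [split=> [p _|v]|exact: closed_omega_x2|].
- exact: kform_omega.
- exact: smooth_affine_coord.
- exact: nondegenerate_omega.
Qed.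

End OmegaAlgebra.

Theorem corollary2p4 (R : realType) :
  let f : 'rV[R]_6 -> R := fun x => x_ 2 x in
  let w : 'rV[R]_6 -> ('I_3 -> 'rV[R]_6) -> R := omega f in
  [/\ multisymplectic setT w,
      ~ (exists U : set 'rV[R]_6,
          nbhs (0 : 'rV[R]_6) U /\
          forall p q, U p -> U q -> same_linear_type (w p) (w q)),
      ~ (exists (U : set 'rV[R]_6) (phi psi : 'rV[R]_6 -> 'rV[R]_6),
          [/\ is_chart U phi psi, U 0 &
              constant_coefficients (phi @` U) (pullback psi w)]) &
      ~ acts_transitively (Diff w)].
Proof.
move=> f w.
have f0 : f 0 = 0 by rewrite /f /x_ mxE.
have not_locally_constant : ~ (exists U : set 'rV[R]_6,
    nbhs (0 : 'rV[R]_6) U /\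
    forall p q, U p -> U q -> same_linear_type (w p) (w q)).
  move=> [U [U0 sameU]].
  have /nbhs_ballP[r /= r0 rU] := U0.
  have qE : x_ 2 (- (r / 2) *: e 2) = - (r / 2).
    by rewrite /x_ mxE -/(x_ 2 (e 2)) x_e// mulr1.
  have Uq : U (- (r / 2) *: e 2).
    apply: rU; split=> // i j; rewrite !mxE -ball_normE /= sub0r mulNr opprK.
    have r2_gt0 : 0 < r / 2 by rewrite divr_gt0.
    rewrite ger0_norm; last exact: mulr_ge0 (ltW r2_gt0) (ler0n _ _).
    by case: (_ && _); rewrite ?mulr1 ?mulr0//; lra.
  apply: (not_same_linear_type_omega f0 _ (sameU _ _ (nbhs_singleton U0) Uq)).
  by rewrite /f qE oppr_lt0 divr_gt0.
split=> //.
- exact: multisymplectic_omega_x2.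
- move=> [U [phi [psi [chart U0 [c wc]]]]]; apply: not_locally_constant.
  exists U; split; first by apply: open_nbhs_nbhs; split=> //; case: chart.
  move=> p q Up Uq; apply: (constant_pullback_same_linear_type chart _ Up Uq) => y z Uy Uz.
  by apply/funext => v; rewrite !wc.
- move=> /(_ 0 (- e 2))[Phi Phiw Phi0].
  have := Diff_same_linear_type 0 Phiw; rewrite Phi0.
  apply: not_same_linear_type_omega => //.
  by rewrite /f /x_ mxE -/(x_ 2 (e 2)) x_e// oppr_lt0.
Qed.
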